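(* Let $\mathcal C$ be a flag pure simplicial complex without boundary and let $\{a,b\}$ be an edge of $\mathcal C$. Let $\mathcal F$ be an intersecting family of facets of $\mathcal C$ such that every member of $\mathcal F$ contains $a$ or $b$. Then at least one of the following holds: the number of facets of $\mathcal C$ containing $a$ is at least $|\mathcal F|$, or the number of facets of $\mathcal C$ containing $b$ is at least $|\mathcal F|$.
   Context: A simplicial complex is a family of subsets (faces) of a finite ground set closed under taking subsets. Edges are faces of size two; facets are inclusion-maximal faces; the complex is pure if all facets have the same size; it is flag if every set of vertices that pairwise span edges is a face. A pure complex is without boundary if every face that is not a facet is contained in at least two facets. A family of facets is intersecting if no two of its members are disjoint. *)

(* Defs.v *)
From mathcomp Require Import all_boot.

Set Implicit Arguments.
Unset Strict Implicit.
Unset Printing Implicit Defensive.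

Section Complexes.

(* The ground set is the whole finite type T; a point x of T is a vertex of C
   only if [set x] is a face, so T may contain points that are not vertices. *)
Variable T : finType.
Implicit Types (C F : {set {set T}}) (S A B : {set T}).

Definition simplicial_complex C : Prop :=
  forall A B, A \in C -> B \subset A -> B \in C.

Definition vertices C : {set T} := [set x | [set x] \in C].

Definition edges C : {set {set T}} := [set A in C | #|A| == 2].

Definition facets C : {set {set T}} := [set A | maxset [in C] A].

Definition pure C : Prop :=
  forall A B, A \in facets C -> B \in facets C -> #|A| = #|B|.

Definition flag C : Prop :=
  forall S, S \subset vertices C ->
    (forall x y, x \in S -> y \in S -> x != y -> [set x; y] \in edges C) ->
    S \in C.

Definition without_boundary C : Prop :=
  forall A, A \in C -> A \notin facets C ->
    2 <= #|[set B in facets C | A \subset B]|.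

Definition intersecting F : Prop :=
  forall A B, A \in F -> B \in F -> A != B -> ~~ [disjoint A & B].

Definition facets_at C (x : T) : {set {set T}} :=
  [set A in facets C | x \in A].

End Complexes.

(* Main.v *)
Require Import Defs.
From mathcomp Require Import all_boot.

(** Facets containing both [a] and [b] count for both stars, so the matter is
    about the families [P] and [Q] of members of [F] that contain only [a],
    resp. only [b].  They sit inside the families [one_sided a b] and
    [one_sided b a] of all such facets, of sizes [m] and [n], and no member of
    [P] is disjoint from a member of [Q].  The theorem follows from the density
    inequality [|P| / m + |Q| / n <= 1]: it bounds [|P| + |Q|] by the larger of
    [m] and [n].

    The density inequality says that a uniformly random pair [(A, B)] of
    one-sided facets can be turned into a pair [(A', B')] that is again uniform
    and satisfies [A :&: B' = set0], since then [A \in P] forces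
    [B' \notin Q].  Such a transformation is built one vertex at a time.  If
    [v] lies in [A] and in [B], the ridges [A :\ v] and [B :\ v] have other
    completions, because there is no boundary; [v] is exchanged for such a
    completion in both facets simultaneously.  Flagness makes this useful: two
    completions of the same ridge are never adjacent ([completions_nonadj]).
    Hence whatever enters [B] is not adjacent to [v], so it is not one of the
    vertices of [A] treated earlier, which are all adjacent to [v].

    To preserve the uniform measure, exchanges must also be performed
    backwards, from pairs that have no common vertex to exchange.  With the
    vertices of [A] listed as [f 0, ..., f (d - 1)], treating position [i]
    amounts to one step of a random walk on pairs [(f, B)]: exchanging [f i] along a
    cyclic rotation
    of the completions, or along its inverse, defines a graph with degree 2 at
    the pairs where [f i \in B] and degree at most 2 elsewhere; loops at the
    latter pairs make it regular.  A regular graph expands every set of states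
    weakly ([leq_card_sym_neighbours]), and weak expansion is preserved by
    composing the steps for [i = 0, ..., d - 1] ([disjoint_expands]).  That is
    all that the density inequality needs.  The ordering of [A] matters: it
    makes the reverse of a step act at the same position as the step itself. *)

Set Implicit Arguments.
Unset Strict Implicit.
Unset Printing Implicit Defensive.

(** * Expansion in regular graphs and an inequality of densities *)

(** Loops of weight [n] minus the degree turn the symmetric weight [w] into one
    with all row and column sums equal to [n]; counting weight from [X] to its
    neighbourhood then gives Hall's inequality.  Points of [D]
    get no such loop. *)
Lemma leq_card_sym_neighbours (S : finType) (Om D : {set S})
    (w : S -> S -> nat) (n : nat) (X : {set S}) :
    0 < n -> {in Om &, forall x y, w x y = w y x} ->
    {in Om, forall x, \sum_(y in Om) w x y <= n} ->
    {in Om, forall x, x \in D -> \sum_(y in Om) w x y = n} ->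
    X \subset Om ->
  #|X| <= #|[set y in Om | [exists x in X, (0 < w x y)
                                         || (y == x) && (x \notin D)]]|.
Proof.
move=> n_gt0 wC w_le w_eq sX; have /subsetP sXO := sX.
set Y := [set y in Om | _].
pose W x y := w x y + (y == x) * (n - \sum_(z in Om) w x z).
have W_row x : x \in Om -> \sum_(y in Om) W x y = n.
  move=> xO; rewrite big_split /= [X in _ + X](bigD1 x) //= eqxx mul1n.
  rewrite [X in _ + (_ + X)]big1 => [|y /andP[_ /negPf->]] //.
  by rewrite addn0 subnKC ?w_le.
have W_sym : {in Om &, forall x y, W x y = W y x}.
  move=> x y xO yO; rewrite /W wC // eq_sym.
  by case: eqP => [->|_]; rewrite // !mul0n.
have sYO y : y \in Y -> y \in Om by rewrite inE => /andP[].
have rows (Z : {set S}) : (forall z, z \in Z -> z \in Om) ->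
    \sum_(x in Z) \sum_(y in Om) W x y = #|Z| * n.
  by move=> ZO; rewrite -sum_nat_const; apply: eq_bigr => z /ZO /W_row.
rewrite -(leq_pmul2r n_gt0) -!rows // exchange_big /=.
rewrite [leqLHS](bigID [in Y]) /= [X in _ + X]big1 ?addn0 => [|y].
  rewrite (eq_bigl [in Y]) => [|y /=]; last first.
    by rewrite andb_idl // => /sYO.
  apply: leq_sum => y yY; rewrite [leqRHS](big_setID X) /= (setIidPr sX).
  apply: leq_trans (leq_addr _ _); apply: eq_leq; apply: eq_bigr => x xX.
  by apply: W_sym; [exact: sXO | exact: sYO].
move=> /andP[yO]; rewrite inE yO /= => /exists_inPn yNY.
apply: big1 => x xX; have := yNY x xX; rewrite /W negb_or -leqNgt leqn0.
move=> /andP[/eqP-> ]; case: (y == x) => //=; rewrite negbK => xD.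
by rewrite w_eq ?sXO // subnn.
Qed.

(** The hypothesis is [p / m + q / n <= 1] cleared of denominators, so [p + q]
    is at most an average of [m] and [n]. *)
Lemma leq_add_maxn p q m n :
  p <= m -> q <= n -> p * n + m * q <= m * n -> p + q <= maxn m n.
Proof.
move=> le_pm le_qn le_mn; case: (leqP m n) => [le|/ltnW le].
  case: (posnP m) => [m0|m_gt0].
    by move: le_pm; rewrite m0 leqn0 => /eqP->.
  rewrite -(leq_pmul2l m_gt0) mulnDr; apply: leq_trans le_mn.
  by rewrite leq_add2r mulnC leq_mul2l le orbT.
case: (posnP n) => [n0|n_gt0].
  by move: le_qn; rewrite n0 leqn0 => /eqP->; rewrite addn0.
rewrite -(leq_pmul2r n_gt0) mulnDl; apply: leq_trans le_mn.
by rewrite leq_add2l mulnC leq_mul2r le orbT.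
Qed.

(** * Cyclic successors have no fixed point *)

Section CyclicSuccessor.
Variables (T : eqType) (s : seq T).
Hypotheses (s_uniq : uniq s) (s_gt1 : 1 < size s).

Lemma next_neq x : x \in s -> next s x != x.
Proof.
move=> xs; case/rot_to: (xs) => i s' def_s.
rewrite -(next_rot i) // def_s.
move: s_uniq s_gt1; rewrite -(rot_uniq i) -(size_rot i) def_s.
case: s' {def_s} => [|y s'] //= /andP[]; rewrite inE negb_or eqxx.
by rewrite eq_sym => /andP[].
Qed.

Lemma prev_neq x : x \in s -> prev s x != x.
Proof.
move=> xs; rewrite -{2}(next_prev s_uniq x) eq_sym.
by apply: next_neq; rewrite mem_prev.
Qed.

End CyclicSuccessor.

(** * Ridges and their completions *)

Section Swap.

Variables (T : finType) (C : {set {set T}}).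
Hypotheses (C_sc : simplicial_complex C) (C_flag : flag C).
Hypothesis C_nb : without_boundary C.
Variable d : nat.
Hypothesis card_facet : forall A, A \in facets C -> #|A| = d.

Definition completions (R : {set T}) : {set T} :=
  [set w | (w \notin R) && (w |: R \in facets C)].

Lemma in_completions R w :
  (w \in completions R) = (w \notin R) && (w |: R \in facets C).
Proof. by rewrite in_set. Qed.

Lemma facet_face A : A \in facets C -> A \in C.
Proof. by rewrite inE => /maxsetP[]. Qed.

Lemma facet_pair A x y : A \in facets C -> x \in A -> y \in A ->
  [set x; y] \in C.
Proof.
move=> /facet_face Aface xA yA; apply: (C_sc Aface).
by rewrite subUset !sub1set xA.
Qed.

(** If [v] and [w] were adjacent, [w |: (v |: R)] would be a clique, hence a
    face that properly contains the facet [v |: R]. *)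
Lemma completions_nonadj R v w :
  v \in completions R -> w \in completions R -> v != w -> [set v; w] \notin C.
Proof.
rewrite !in_completions => /andP[vR vF] /andP[wR wF] neq_vw; apply/negP => vwC.
have pairC x y : x \in w |: (v |: R) -> y \in w |: (v |: R) ->
    [set x; y] \in C.
  have V := facet_pair vF; have W := facet_pair wF.
  have vv : v \in v |: R by rewrite setU11.
  have ww : w \in w |: R by rewrite setU11.
  move=> /setU1P[->|xA] /setU1P[->|yA]; last exact: V.
  - exact: W.
  - case/setU1P: yA => [->|yR]; first by rewrite setUC.
    by apply: W; rewrite // setU1r.
  - case/setU1P: xA => [->|xR] //.
    by apply: W; rewrite // setU1r.
have Aface : w |: (v |: R) \in C.
  apply: C_flag => [|x y xA yA neq_xy].
    apply/subsetP => x xA; rewrite inE; have := pairC x x xA xA.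
    by rewrite setUid.
  by rewrite inE cards2 neq_xy eqxx pairC.
move: vF; rewrite inE => /maxsetP[_ max_v].
have := max_v _ Aface (subsetUr _ _) => /setP/(_ w).
by rewrite setU11 !inE eq_sym (negPf neq_vw) (negPf wR).
Qed.

Lemma card_completions R v : v \in completions R -> 1 < #|completions R|.
Proof.
rewrite in_completions => /andP[vR vF].
have RC : R \in C by apply: (C_sc (facet_face vF)); apply: subsetUr.
have RNF : R \notin facets C.
  apply/negP => /card_facet; rewrite -(card_facet vF) cardsU1 vR.
  exact: n_Sn.
apply: leq_trans (C_nb RC RNF) _.
apply: leq_trans (leq_imset_card (fun w => w |: R) _).
apply/subset_leq_card/subsetP => B; rewrite in_set => /andP[BF sRB].
have: #|B :\: R| = 1.
  rewrite cardsD (setIidPr sRB) (card_facet BF) -(card_facet vF) cardsU1 vR.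
  by rewrite addnK.
move=> /eqP/cards1P[w def_w].
have def_B : B = w |: R.
  by rewrite -def_w setUC setDE setUIr setUCr setIT (setUidPr sRB).
apply/imsetP; exists w => //; rewrite in_completions -def_B BF andbT.
by have := set11 w; rewrite -def_w inE => /andP[].
Qed.

(** * Exchanging a common vertex of two one-sided facets *)

Variables (a b : T).

Definition one_sided (x y : T) : {set {set T}} :=
  [set A in facets C | (x \in A) && (y \notin A)].

Lemma in_one_sided x y A :
  (A \in one_sided x y) = [&& A \in facets C, x \in A & y \notin A].
Proof. by rewrite in_set. Qed.

Local Notation state := ({ffun 'I_d -> T} * {set T})%type.

Implicit Types (f g : {ffun 'I_d -> T}) (B D : {set T}).

Definition verts (f : {ffun 'I_d -> T}) : {set T} := f @: setT.

Definition valid : {set state} :=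
  [set x : state | [&& injectiveb x.1, verts x.1 \in one_sided a b
             & x.2 \in one_sided b a]].

Definition rest (f : {ffun 'I_d -> T}) (i : 'I_d) : {set T} := f @: [set~ i].

Definition put (f : {ffun 'I_d -> T}) i v : {ffun 'I_d -> T} :=
  [ffun j => if j == i then v else f j].

Lemma vertsE f i : verts f = f i |: rest f i.
Proof. by rewrite /verts /rest -(setUCr [set i]) imsetU imset_set1. Qed.

Lemma rest_put f i v : rest (put f i v) i = rest f i.
Proof.
by apply: eq_in_imset => j; rewrite !inE ffunE => /negPf->.
Qed.

Lemma put_id f i v : put f i v i = v. Proof. by rewrite ffunE eqxx. Qed.

Lemma put_inj f i v :
  injective f -> v \notin rest f i -> injective (put f i v).
Proof.
move=> f_inj vR j k; rewrite !ffunE.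
have nv l : l != i -> v <> f l.
  by move=> li vE; case/negP: vR; rewrite vE imset_f // !inE.
case: eqVneq => [->|ji]; case: eqVneq => [->|ki] //; last exact: f_inj.
  by move/(nv k ki).
by move/esym/(nv j ji).
Qed.

(** Only meaningful when [f i] lies in [B]; the exchanges in the two facets are
    governed by one rule [s], applied to two different ridges. *)
Definition swap (s : {set T} -> T -> T) (i : 'I_d) (x : state) : state :=
  let: (f, B) := x in let v := f i in
  (put f i (s (rest f i) v), s (B :\ v) v |: (B :\ v)).

Definition clash (i : 'I_d) : {set state} := [set x : state | x.1 i \in x.2].

(** All that the composition of steps has to know about one step: the order of
    the first facet changes at [i] only, whatever enters the second facet is not
    adjacent to the old vertex at [i], and that vertex ends up outside. *)
Definition step (i : 'I_d) (x y : state) : Prop :=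
  [/\ forall j, j != i -> y.1 j = x.1 j,
      forall z, z \in y.2 -> z \notin x.2 -> [set z; x.1 i] \notin C
    & x.1 i \notin y.2].

Lemma validP f B : reflect
  [/\ injective f, verts f \in facets C, B \in facets C,
      a \in verts f /\ b \notin verts f & b \in B /\ a \notin B]
  ((f, B) \in valid).
Proof.
rewrite [_ \in valid]in_set /= !in_one_sided; apply: (iffP and3P).
  by case=> /injectiveP ? /and3P[? ? ?] /and3P[? ? ?].
by case=> ? -> -> [-> ->] [-> ->]; split => //; apply/injectiveP.
Qed.

Lemma rest_notin (f : {ffun 'I_d -> T}) i : injective f -> f i \notin rest f i.
Proof.
move=> f_inj; apply/imsetP => -[j]; rewrite !inE => ji /f_inj eij.
by rewrite eij eqxx in ji.
Qed.

Lemma clash_completions i f B : (f, B) \in valid -> f i \in B ->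
  f i \in completions (rest f i) /\ f i \in completions (B :\ f i).
Proof.
case/validP => f_inj fF BF _ _ fB.
rewrite !in_completions rest_notin // -vertsE fF.
by split; rewrite // setD11 setD1K.
Qed.

(** [s R] moves every completion of the ridge [R], and [t R] is its inverse. *)
Definition rotation (s t : {set T} -> T -> T) : Prop :=
  forall R v, v \in completions R ->
    [/\ s R v \in completions R, s R v != v & t R (s R v) = v].

Section OneRotation.

Variables (s t : {set T} -> T -> T).
Hypothesis st : rotation s t.
Variable i : 'I_d.

Lemma swap_facts f B : (f, B) \in valid -> f i \in B ->
  let v := f i in let w := s (rest f i) v in let u := s (B :\ v) v in
  [/\ w \in completions (rest f i), u \in completions (B :\ v),
      [set v; w] \notin C & [set v; u] \notin C].
Proof.
move=> xO fB; have [vR vB] := clash_completions xO fB; move=> v w u.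
have [wR wv _] := st vR; have [uB uv _] := st vB.
split=> //; first by apply: completions_nonadj vR wR _; rewrite eq_sym.
by apply: completions_nonadj vB uB _; rewrite eq_sym.
Qed.

(** The vertex [f i] is adjacent to [b] through [B] and to [a] through the other
    facet, so neither [a] nor [b] can enter in its place. *)
Lemma swap_valid x : x \in valid -> x \in clash i -> swap s i x \in valid.
Proof.
case: x => f B xO; rewrite inE /= => fB.
have [wR uB vw vu] := swap_facts xO fB.
have [f_inj fF BF [af bf] [bB aB]] := validP _ _ xO.
have fif : f i \in verts f by rewrite imset_f.
have nb v' z A : A \in facets C -> v' \in A -> [set v'; z] \notin C ->
    z \notin A.
  by move=> AF vA; apply: contraNN => zA; apply: facet_pair AF _ _.
move: wR uB; rewrite !in_completions => /andP[wR wF] /andP[uB uF].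
apply/validP; rewrite (vertsE _ i) put_id rest_put; split => //.
- exact: put_inj.
- rewrite (vertsE f i) in af bf.
  split; first by case/setU1P: af aB => [->|? _]; [rewrite fB | rewrite setU1r].
  apply: contraNN bf => /setU1P[bE|bR]; last by rewrite setU1r.
  by have := nb _ _ _ BF fB vw; rewrite -bE bB.
- split; first by rewrite setU1r // !inE bB andbT; apply: contraNneq bf => ->.
  apply/setU1P => -[aE|]; last by rewrite inE (negPf aB) andbF.
  by have := nb _ _ _ fF fif vu; rewrite -aE af.
Qed.

Lemma step_swap x : x \in valid -> x \in clash i -> step i x (swap s i x).
Proof.
case: x => f B xO; rewrite inE /= => fB.
have [wR uB vw vu] := swap_facts xO fB; split=> [j ji|z|] /=.
- by rewrite ffunE (negPf ji).
- by case/setU1P => [->|/setD1P[_ ->]] // _; rewrite setUC.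
have [_ uv _] := st (clash_completions xO fB).2.
by rewrite !inE eqxx /= orbF eq_sym.
Qed.

(** A backward exchange is also a legitimate step: the returning vertex is not
    adjacent to its replacement in [f], which is therefore absent from [B]. *)
Lemma step_unswap x : x \in valid -> x \in clash i -> step i (swap s i x) x.
Proof.
case: x => f B xO; rewrite inE /= => fB.
have [wR uB vw vu] := swap_facts xO fB.
have [_ _ BF _ _] := validP _ _ xO.
split=> [j ji|z zB|] /=; rewrite ?put_id.
- by rewrite ffunE (negPf ji).
- by rewrite !inE zB andbT negb_or negbK => /andP[_ /eqP->].
by apply: contraNN vw => wB; apply: facet_pair BF _ _.
Qed.

(** If the new vertex at [i] is again common to both facets, it must be the
    vertex that has just entered the second one, as all other vertices there are
    adjacent to the old vertex; so the exchange can be undone by [t]. *)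
Lemma swapK x : x \in valid -> x \in clash i -> swap s i x \in clash i ->
  swap t i (swap s i x) = x.
Proof.
case: x => f B xO; rewrite !inE /= => fB.
have [wR uB vw vu] := swap_facts xO fB.
have [_ _ BF _ _] := validP _ _ xO.
have [vR vB] := clash_completions xO fB.
have [_ _ wK] := st vR; have [_ _ uK] := st vB.
rewrite put_id rest_put => /orP[/eqP wu|/andP[_ wB]]; last first.
  by case/negP: vw; apply: facet_pair BF _ _.
rewrite wK; congr (_, _).
  by apply/ffunP => j; rewrite !ffunE; case: eqVneq => [->|].
rewrite {}wu setU1K ?uK ?setD1K //.
by move: uB; rewrite in_completions => /andP[].
Qed.

(** The position [i] tells which vertex entered the first facet; in the second
    facet the entering vertex is the only one not adjacent to the old vertex. *)
Lemma swap_inj : {in valid :&: clash i &, injective (swap s i)}.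
Proof.
move=> [f B] [g D] /setIP[xO xi] /setIP[yO yi] eq_xy.
have fB : f i \in B by move: xi; rewrite inE.
have gD : g i \in D by move: yi; rewrite inE.
have [_ uB _ vu] := swap_facts xO fB; have [_ uD _ vu'] := swap_facts yO gD.
have [[vR _] [vR' _]] := (clash_completions xO fB, clash_completions yO gD).
have [[_ _ wK] [_ _ wK']] := (st vR, st vR').
have [_ _ BF _ _] := validP _ _ xO; have [_ _ DF _ _] := validP _ _ yO.
case: eq_xy => eq_f eq_B.
have eqR : rest f i = rest g i.
  by rewrite -(rest_put f i (s (rest f i) (f i))) eq_f rest_put.
have eqv : f i = g i.
  have := congr1 (fun h : {ffun _} => h i) eq_f.
  by rewrite /= !put_id eqR -{2}wK -{2}wK' eqR => ->.
have eqf : f = g.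
  apply/ffunP => j; have /ffunP/(_ j) := eq_f; rewrite !ffunE.
  by case: eqVneq => [->|].
rewrite {}eqf in fB uB vu eq_B {xO xi vR wK eq_f eqR eqv} *; congr (_, _).
set u := s _ _ in uB vu eq_B; set u' := s _ _ in uD vu' eq_B.
have uu' : u = u'.
  have: u \in u' |: D :\ g i by rewrite -eq_B setU11.
  case/setU1P => // /setD1P[_ uInD].
  by case/negP: vu; apply: facet_pair DF _ _.
rewrite -(setD1K fB) -(setD1K gD); congr (_ |: _).
move: uB uD; rewrite !in_completions => /andP[uB _] /andP[uD _].
by rewrite -(setU1K uB) eq_B uu' setU1K.
Qed.

End OneRotation.

(** * Expansion of one step and of all steps *)

Definition rot_next (R : {set T}) (v : T) := next (enum (completions R)) v.
Definition rot_prev (R : {set T}) (v : T) := prev (enum (completions R)) v.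

Lemma rotation_next : rotation rot_next rot_prev.
Proof.
move=> R v vR; have e_uniq := enum_uniq (mem (completions R)).
split; last exact: prev_next.
  by rewrite -mem_enum mem_next mem_enum.
by apply: next_neq; rewrite ?mem_enum // -cardE (card_completions vR).
Qed.

Lemma rotation_prev : rotation rot_prev rot_next.
Proof.
move=> R v vR; have e_uniq := enum_uniq (mem (completions R)).
split; last exact: next_prev.
  by rewrite -mem_enum mem_prev mem_enum.
by apply: prev_neq; rewrite ?mem_enum // -cardE (card_completions vR).
Qed.

(** The walk exchanges along [rot_next] and [rot_prev], once each, so a state
    with a clash at [i] has degree 2, and injectivity of both exchanges bounds
    the degree of the other states by 2. *)
Lemma step_expands i (X : {set state}) : X \subset valid ->
  exists2 Y : {set state}, (Y \subset valid) && (#|X| <= #|Y|) &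
    forall y, y \in Y -> exists2 x, x \in X & step i x y.
Proof.
move=> sXO; pose p := swap rot_next i; pose q := swap rot_prev i.
pose c (x y : state) := (p x == y) + (q x == y).
(* A state without clash has only backward exchanges, hence [c y x]. *)
pose w (x y : state) := if x \in clash i then c x y
                        else if y \in clash i then c y x else 0.
have wC : {in valid &, forall x y, w x y = w y x}.
  move=> x y xO yO; rewrite /w; case: ifP => xi; case: ifP => yi //.
  rewrite /c addnC; congr (nat_of_bool _ + nat_of_bool _); apply/eqP/eqP => E.
  - by rewrite -{y}E in yO yi *; apply: (swapK rotation_prev).
  - by rewrite -{x}E in xO xi *; apply: (swapK rotation_next).
  - by rewrite -{y}E in yO yi *; apply: (swapK rotation_next).
  - by rewrite -{x}E in xO xi *; apply: (swapK rotation_prev).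
have w_eq : {in valid, forall x, x \in clash i -> \sum_(y in valid) w x y = 2}.
  move=> x xO xi; under eq_bigr do rewrite /w xi.
  have one z : z \in valid -> \sum_(y in valid) (z == y) = 1.
    move=> zO; rewrite (bigD1 z) //= eqxx big1 // => y /andP[_].
    by rewrite eq_sym => /negPf->.
  rewrite big_split /= !one //; first exact: (swap_valid rotation_prev).
  exact: (swap_valid rotation_next).
have w_le : {in valid, forall x, \sum_(y in valid) w x y <= 2}.
  move=> x xO; have [/w_eq->//|xi] := boolP (x \in clash i).
  have le1 (r : state -> state) : {in valid :&: clash i &, injective r} ->
      \sum_(y in valid :&: clash i) (r y == x) <= 1.
    move=> r_inj; rewrite -big_mkcondr /= sum1_card.
    apply/card_le1_eqP => y z /andP[yO /eqP ry] /andP[zO /eqP rz].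
    by apply: r_inj; rewrite ?ry ?rz.
  have := leq_add (le1 p (swap_inj rotation_next (i := i)))
                  (le1 q (swap_inj rotation_prev (i := i))).
  rewrite -big_split /=; apply: leq_trans; apply: eq_leq.
  under [RHS]eq_bigl do rewrite inE.
  by rewrite [RHS]big_mkcondr; apply: eq_bigr => y _; rewrite /w (negPf xi).
have := leq_card_sym_neighbours (ltn0Sn 1) wC w_le w_eq sXO.
set Y := [set y in _ | _] => leXY; exists Y.
  by rewrite leXY andbT; apply/subsetP => y; rewrite inE => /andP[].
move=> y; rewrite inE => /andP[yO /exists_inP[x xX w_xy]]; exists x => //.
have xO := subsetP sXO x xX; move: w_xy; rewrite /w /c.
case: ifPn => [xi|xi].
  rewrite andbF orbF addn_gt0 !lt0b => /orP[]/eqP<-.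
    exact: (step_swap rotation_next).
  exact: (step_swap rotation_prev).
case: ifPn => [yi|yi] /=; last first.
  by rewrite andbT => /eqP->; split=> // [z ->|] //; move: xi; rewrite inE.
case/orP => [|/andP[/eqP yx _]]; last by rewrite yx (negPf xi) in yi.
rewrite addn_gt0 !lt0b => /orP[]/eqP<-.
  exact: (step_unswap rotation_next).
exact: (step_unswap rotation_prev).
Qed.

(** Invariant before step [k]: the positions from [k] on still carry the
    original vertices, and the original vertices at earlier positions are
    outside the second facet.  They stay outside, because what enters at step [k] is not
    adjacent to the original vertex at [k], whereas they are. *)
Lemma disjoint_expands (X : {set state}) : X \subset valid ->
  exists2 Y : {set state}, (Y \subset valid) && (#|X| <= #|Y|) &
    forall y, y \in Y -> exists2 x, x \in X & [disjoint verts x.1 & y.2].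
Proof.
move=> sXO.
pose good k (x y : state) := forall j : 'I_d,
  if j < k then x.1 j \notin y.2 else y.1 j == x.1 j.
suffices [Y YO Yok]: exists2 Y : {set state},
    (Y \subset valid) && (#|X| <= #|Y|) &
    forall y, y \in Y -> exists2 x, x \in X & good d x y.
  exists Y => // y /Yok[x xX xy]; exists x => //.
  rewrite disjoint_subset; apply/subsetP => _ /imsetP[j _ ->].
  by have := xy j; rewrite ltn_ord inE.
suffices /(_ d (leqnn d)) : forall k, k <= d -> exists2 Y : {set state},
    (Y \subset valid) && (#|X| <= #|Y|) &
    forall y, y \in Y -> exists2 x, x \in X & good k x y by [].
elim=> [_|k IHk ltkd].
  by exists X; rewrite ?sXO ?leqnn // => y yX; exists y => // j; rewrite ltn0.
have [Y /andP[sYO leXY] Yok] := IHk (ltnW ltkd).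
pose i := Ordinal ltkd.
have [Z /andP[sZO leYZ] Zok] := step_expands i sYO; exists Z.
  by rewrite sZO (leq_trans leXY).
move=> z /Zok[y yY [keep enter leave]]; have [x xX xy] := Yok y yY.
exists x => // j; have := xy i; rewrite ltnn => /eqP yi.
rewrite ltnS leq_eqVlt; have [jk|jk] := eqVneq (j : nat) k.
  by have -> : j = i; [exact: val_inj | rewrite /= -yi].
have ji : j != i by rewrite -val_eqE.
rewrite /= keep //; have := xy j; case: ifP => // _ xjy.
apply/negP => /enter/(_ xjy)/negP[]; rewrite yi.
have := subsetP sXO x xX; case: x {xX xy yi xjy} => f B /validP[_ fF _ _ _].
by apply: facet_pair fF _ _; rewrite imset_f.
Qed.

(** Every facet can be ordered in the same number of ways, so counting states
    amounts to counting pairs of unordered facets. *)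
Lemma card_states (P Q : {set {set T}}) :
    P \subset one_sided a b -> Q \subset one_sided b a ->
  #|[set x : state in valid | (verts x.1 \in P) && (x.2 \in Q)]|
    = #|P| * #|Q| * d`!.
Proof.
move=> sP sQ.
pose E A := [set f : {ffun 'I_d -> T} | injectiveb f && (verts f == A)].
have cardE A : A \in facets C -> #|E A| = d`!.
  move=> AF; have := card_inj_ffuns_on 'I_d [in A].
  rewrite card_ord (card_facet AF) ffactnn => <-; apply: eq_card => f.
  rewrite !inE andbC; case: injectiveP => f_inj; rewrite ?andbF // !andbT.
  apply/eqP/ffun_onP => [<- j|fA]; first by rewrite imset_f.
  apply/eqP; rewrite eqEcard card_imset // cardsT card_ord (card_facet AF).
  by rewrite leqnn andbT; apply/subsetP => _ /imsetP[j _ ->]; apply: fA.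
rewrite -sum1_card (partition_big (fun x : state => verts x.1) [in P]) /=
  => [|x]; last by rewrite inE => /and3P[].
rewrite -mulnA -sum_nat_const; apply: eq_bigr => A AP.
have := subsetP sP A AP; rewrite in_one_sided => /andP[AF Aab].
rewrite sum1_card -(cardE A AF) mulnC -cardsX; apply: eq_card => -[f B].
rewrite [in LHS]unfold_in !inE /=.
case: (verts f =P A) => [->|]; last by rewrite !andbF.
case BQ: (B \in Q); rewrite ?andbF // AP !andbT.
move: AF Aab (subsetP sQ B BQ); rewrite !inE => -> -> ->.
by rewrite !andbT.
Qed.

(** * The density inequality and the theorem *)

(** The states with first facet in [P] expand to a set of states whose second
    facet misses some member of [P], hence is outside [Q]. *)
Lemma cross_intersecting_density (P Q : {set {set T}}) :
    P \subset one_sided a b -> Q \subset one_sided b a ->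
    (forall A B, A \in P -> B \in Q -> ~~ [disjoint A & B]) ->
  #|P| * #|one_sided b a| + #|one_sided a b| * #|Q|
    <= #|one_sided a b| * #|one_sided b a|.
Proof.
move=> sP sQ crossPQ; rewrite -(leq_pmul2r (fact_gt0 d)) mulnDl.
rewrite -!card_states //.
set X := [set x in _ | _]; set Z := [set x in _ | _]; set V := [set x in _ | _].
have sXO : X \subset valid by apply/subsetP => x; rewrite inE => /andP[].
have [Y /andP[sYO leXY] Yok] := disjoint_expands sXO.
have VE : V = valid.
  by apply/setP => x; rewrite [x \in V]inE andb_idr // inE => /and3P[_ -> ->].
have sZO : Z \subset valid by apply/subsetP => x; rewrite inE => /andP[].
have YZ : [disjoint Y & Z].
  rewrite disjoint_subset; apply/subsetP => y /Yok[x].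
  rewrite inE => /and3P[_ xP _] xy; rewrite !inE.
  by apply/negP => /and3P[_ _ yQ]; have := crossPQ _ _ xP yQ; rewrite xy.
apply: leq_trans (leq_add leXY (leqnn _)) _; rewrite VE.
have := (leq_card_setU Y Z).2; rewrite YZ => /eqP<-.
by apply: subset_leq_card; rewrite subUset sYO.
Qed.

End Swap.

Theorem theorem1p10 (T : finType) (C : {set {set T}}) (a b : T)
    (F : {set {set T}}) :
  simplicial_complex C -> flag C -> pure C -> without_boundary C ->
  [set a; b] \in edges C ->
  F \subset facets C ->
  intersecting F ->
  (forall A : {set T}, A \in F -> (a \in A) || (b \in A)) ->
  #|F| <= #|facets_at C a| \/ #|F| <= #|facets_at C b|.
Proof.
move=> C_sc C_flag C_pure C_nb ab_edge sFC F_int F_cover.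
have [->|[A0 A0F]] := set_0Vmem F; first by left; rewrite cards0.
have card_facet A : A \in facets C -> #|A| = #|A0|.
  by move=> AF; apply: C_pure => //; apply: subsetP A0F.
pose Cab := [set A in facets C | (a \in A) && (b \in A)].
pose P := F :&: one_sided C a b; pose Q := F :&: one_sided C b a.
have card_at x y : #|facets_at C x| =
    #|[set A in facets C | (x \in A) && (y \in A)]| + #|one_sided C x y|.
  rewrite -(cardsID [set A : {set T} | y \in A]).
  by congr (_ + _); apply: eq_card => A; rewrite !inE;
    case: (maxset _ _) (x \in A) (y \in A) => [] [] [].
have card_F : #|F| <= #|Cab| + (#|P| + #|Q|).
  have sF : F \subset Cab :|: (P :|: Q).
    apply/subsetP => A AF; have := F_cover A AF.
    have := subsetP sFC A AF; rewrite !inE AF => -> /=.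
    by case: (a \in A) (b \in A) => [] [].
  apply: leq_trans (subset_leq_card sF) _.
  apply: leq_trans (leq_card_setU _ _) _.
  by rewrite leq_add2l leq_card_setU.
have crossPQ A B : A \in P -> B \in Q -> ~~ [disjoint A & B].
  rewrite !inE => /and3P[AF _ /andP[aA bA]] /and3P[BF _ /andP[bB aB]].
  by apply: F_int => //; apply: contraNneq aB => <-.
have le_P : #|P| <= #|one_sided C a b| by apply/subset_leq_card/subsetIr.
have le_Q : #|Q| <= #|one_sided C b a| by apply/subset_leq_card/subsetIr.
have density := cross_intersecting_density C_sc C_flag C_nb card_facet
  (subsetIr _ _) (subsetIr _ _) crossPQ.
have := leq_add_maxn le_P le_Q density.
have Cba : [set A in facets C | (b \in A) && (a \in A)] = Cab.
  by apply/setP => A; rewrite !inE [_ && (a \in A)]andbC.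
rewrite leq_max (card_at a b) (card_at b a) Cba => /orP[le_ab|le_ba].
  by left; apply: leq_trans card_F _; rewrite leq_add2l.
by right; apply: leq_trans card_F _; rewrite leq_add2l.
Qed.
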